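(* Let $R$ be a commutative ring and let $M_1, M_2, M_3$ be finitely presented $R$-modules. (i) If $M_1 \hookrightarrow M_2 \twoheadrightarrow M_3$ is a (short) exact sequence, then $\mathrm{Fit}_R(M_1)\cdot \mathrm{Fit}_R(M_3) \subset \mathrm{Fit}_R(M_2)$. (ii) If in addition $M_3$ has a quadratic presentation (i.e. an exact sequence of the form $R^k \to R^k \twoheadrightarrow M_3$ for some $k\in\mathbb{N}$, where $R^k\to R^k$ is not required to be injective), then $\mathrm{Fit}_R(M_1)\cdot \mathrm{Fit}_R(M_3) = \mathrm{Fit}_R(M_2)$.
   Context: $\mathrm{Fit}_R(N)$ is the usual (zeroth) Fitting ideal of a finitely presented $R$-module $N$: for a presentation $R^a \xrightarrow{h} R^b \twoheadrightarrow N$ it is the ideal of $R$ generated by all $b\times b$ minors of the $a \times b$ matrix of $h$ if $a\ge b$, and $0$ if $a<b$ (independent of the presentation). *)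

(* Defs.v *)
From HB Require Import structures.
From mathcomp Require Import all_boot all_order all_algebra.
From mathcomp Require Import boolp classical_sets.

Set Implicit Arguments.
Unset Strict Implicit.
Unset Printing Implicit Defensive.

Import GRing.Theory.
Local Open Scope classical_set_scope.
Local Open Scope ring_scope.

(* Commutative rings are [comPzRingType]: the zero ring is allowed. *)

Section Ideals.
Variable R : comPzRingType.

Definition is_ideal (I : set R) : Prop :=
  [/\ I 0, forall x y, I x -> I y -> I (x + y) & forall a x, I x -> I (a * x)].

Definition ideal_gen (S : set R) : set R := smallest is_ideal S.

Definition ideal_mul (I J : set R) : set R :=
  ideal_gen [set x * y | x in I & y in J].

End Ideals.

Section Exactness.
Variables (R : comPzRingType) (L M N : lmodType R).

Definition exact_at (f : {linear L -> M}) (g : {linear M -> N}) : Prop :=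
  range f = g @^-1` [set 0].

Definition right_exact (f : {linear L -> M}) (g : {linear M -> N}) : Prop :=
  exact_at f g /\ range g = setT.

Definition short_exact (f : {linear L -> M}) (g : {linear M -> N}) : Prop :=
  injective f /\ right_exact f g.

End Exactness.

Section Fitting.
Variable R : comPzRingType.

(* R^n is the module of row vectors, on which the matrix A of h : R^a -> R^b
   acts by u |-> u *m A; row i of A is the image of the i-th basis vector. *)
Definition presents (a b : nat) (A : 'M[R]_(a, b)) (N : lmodType R) : Prop :=
  exists p : {linear 'rV[R]_b -> N}, right_exact (mulmxr A) p.

Definition finitely_presented (N : lmodType R) : Prop :=
  exists (a b : nat) (A : 'M[R]_(a, b)), presents A N.

Definition has_quadratic_presentation (N : lmodType R) : Prop :=
  exists (k : nat) (A : 'M[R]_k), presents A N.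

(* A b x b minor is given by a strictly increasing choice of b rows. There is
   none if a < b, and the ideal is then 0; if b = 0 the only minor is the empty
   determinant 1. *)
Definition maximal_minors (a b : nat) (A : 'M[R]_(a, b)) : set R :=
  [set \det (rowsub s A) | s in
    [set s : 'I_b -> 'I_a | {homo s : i j / (i < j)%N}]].

(* By Fitting's lemma the ideals of minors of all presentations of N coincide,
   so this union over the presentations is equal to each of its members. *)
Definition Fit (N : lmodType R) : set R :=
  [set x | exists (a b : nat) (A : 'M[R]_(a, b)),
     presents A N /\ ideal_gen (maximal_minors A) x].

End Fitting.

(* Main.v *)
(* Given a surjection p : R^b -> N, let F(p) be the ideal generated by the
   determinants of the b x b matrices whose rows lie in ker p. If ker p is the
   row space of A, these matrices are the W *m A, so by Cauchy-Binet F(p) is the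
   ideal of maximal minors of A. Expanding along the last columns, det [Z | W] is
   in F(p) as soon as the rows of Z, but not necessarily those of W, are in ker p;
   with unimodular block operations this makes F(p) independent of p.
   For 0 -> M1 -> M2 -> M3 -> 0, cover M2 by p2 : R^b1 x R^b3 -> M2 built from
   covers p1, p3 of M1, M3. Relations B1, B3 of p1, p3 give the relation matrix
   [B1, 0; X, B3] of p2, which is (i). If ker p3 is the row space of a square
   matrix A, every relation matrix of p2 factors as [Z | W] * [1, 0; X, A] with
   the rows of Z in ker p1, which is (ii). *)
From HB Require Import structures.
Require Import Defs.
From mathcomp Require Import all_boot all_order all_fingroup all_algebra.
From mathcomp Require Import boolp classical_sets.

Local Open Scope classical_set_scope.
Local Open Scope ring_scope.

Import GRing.Theory.

Set Implicit Arguments.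
Unset Strict Implicit.
Unset Printing Implicit Defensive.

(** * Generated ideals and their products *)

Section IdealGen.
Variable R : comPzRingType.
Implicit Types (S T I : set R).

Lemma ideal_gen_is_ideal S : is_ideal (ideal_gen S).
Proof.
split=> [I [] [] //|x y Sx Sy I II|a x Sx I II].
- by case: (II) => -[_ ID _] _; apply: ID; [apply: Sx | apply: Sy].
- by case: (II) => -[_ _ IM] _; apply: IM; apply: Sx.
Qed.

Lemma mem_ideal_gen S : S `<=` ideal_gen S.
Proof. exact: sub_gen_smallest. Qed.

Lemma ideal_gen_le S I : is_ideal I -> S `<=` I -> ideal_gen S `<=` I.
Proof. exact: smallest_sub. Qed.

Lemma ideal_sum I (J : finType) (P : pred J) (F : J -> R) :
  is_ideal I -> (forall j, P j -> I (F j)) -> I (\sum_(j | P j) F j).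
Proof. by case=> I0 ID _; apply: (big_ind I). Qed.

(** For a fixed factor [y], the [z] with [z * y] in [I] form an ideal, so generators suffice in one
    factor, and then likewise in the other. *)
Lemma ideal_mul_gen_le S T I : is_ideal I ->
  (forall x y, S x -> T y -> I (x * y)) ->
  ideal_mul (ideal_gen S) (ideal_gen T) `<=` I.
Proof.
move=> II STI; have [I0 ID IM] := II.
apply: ideal_gen_le => // _ [x Sx [y Ty <-]].
apply: (@ideal_gen_le S (fun z => I (z * y))) Sx => [|{}x Sx].
  split=> [|u v Iu Iv|a u Iu]; first by rewrite mul0r.
  - by rewrite mulrDl; apply: ID.
  - by rewrite -mulrA; apply: IM.
apply: (@ideal_gen_le T (fun z => I (x * z))) Ty => [|{}y Ty]; last exact: STI.
split=> [|u v Iu Iv|a u Iu]; first by rewrite mulr0.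
- by rewrite mulrDr; apply: ID.
- by rewrite mulrCA; apply: IM.
Qed.

Lemma mem_ideal_mul S T x y : S x -> T y -> ideal_mul S T (x * y).
Proof. by move=> Sx Ty; apply: mem_ideal_gen; exists x => //; exists y. Qed.

End IdealGen.

(** * Maximal minors and the Cauchy-Binet expansion *)

Section MaximalMinors.
Variable R : comPzRingType.

Lemma sort_injection (a b : nat) (s : 'I_b -> 'I_a) : injective s ->
  exists (t : 'I_b -> 'I_a) (r : 'S_b),
    {homo t : i j / (i < j)%N} /\ s =1 t \o r.
Proof.
(* The rank of [i] is the number of indices with a smaller value under [s]; by injectivity ranks
   form a permutation, and reindexing by rank sorts [s]. *)
move=> s_inj; pose below i := [set j | (s j < s i)%N]%SET.
have below_lt i : (#|below i| < b)%N.
  rewrite -[X in (_ < X)%N]card_ord; apply/proper_card/properP.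
  by split; [exact/fintype.subsetP | exists i; rewrite // inE ltnn].
pose rank i := Ordinal (below_lt i).
have rank_lt i j : (s i < s j)%N -> (rank i < rank j)%N.
  move=> ij; apply/proper_card/properP; split.
    by apply/fintype.subsetP=> k; rewrite !inE => /ltn_trans; apply.
  by exists i; rewrite !inE ?ltnn.
have rank_inj : injective rank.
  move=> i j eq_ij; apply/s_inj/val_inj.
  by case: (ltngtP (s i) (s j)) => [/rank_lt|/rank_lt|//]; rewrite eq_ij ltnn.
pose r := perm rank_inj.
exists (s \o r^-1%g), r; split=> [i j|i] /=; last by rewrite permK.
rewrite -{1}[i](permKV r) -{1}[j](permKV r).
set i' := r^-1%g i; set j' := r^-1%g j; rewrite !permE => ij.
case: (ltngtP (s i') (s j')) => // [/rank_lt|/val_inj/s_inj eq_ij].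
  by rewrite ltnNge (ltnW ij).
by rewrite eq_ij ltnn in ij.
Qed.

(** A repeated row gives determinant 0; otherwise sorting the rows changes the determinant only by a
    sign. *)
Lemma det_rowsub_maximal_minor (a b : nat) (A : 'M[R]_(a, b))
    (s : 'I_b -> 'I_a) :
  ideal_gen (maximal_minors A) (\det (rowsub s A)).
Proof.
have [I0 _ IM] := ideal_gen_is_ideal (maximal_minors A).
have [s_inj|] := boolP (injectiveb s); last first.
  case/injectivePn=> i [j ij sij].
  by rewrite (determinant_alternate ij) // => k; rewrite !mxE sij.
have [t [r [t_lt str]]] := sort_injection (injectiveP _ s_inj).
have -> : rowsub s A = row_perm r (rowsub t A).
  by apply/matrixP=> i j; rewrite !mxE str.
rewrite row_permE det_mulmx; apply: IM.
by apply: mem_ideal_gen; exists t.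
Qed.

(* Half of the Cauchy-Binet formula: [\det (W *m A)] is a combination of the
   determinants of all, not only increasing, selections of rows of [A]. *)
Lemma det_mulmx_maximal_minor (a b : nat) (W : 'M[R]_(b, a))
    (A : 'M[R]_(a, b)) :
  ideal_gen (maximal_minors A) (\det (W *m A)).
Proof.
have II := ideal_gen_is_ideal (maximal_minors A).
have -> : \det (W *m A) = \sum_(s : {ffun 'I_b -> 'I_a})
    (\prod_i W i (s i)) * \det (rowsub s A).
  under [RHS]eq_bigr do rewrite big_distrr /=.
  rewrite exchange_big; apply: eq_bigr => /= r _.
  under [RHS]eq_bigr do rewrite mulrCA -big_split /=.
  rewrite -big_distrr /=; congr (_ * _).
  under eq_bigr do rewrite mxE.
  rewrite bigA_distr_bigA; apply: eq_bigr => s _.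
  by apply: eq_bigr => i _; rewrite mxE.
apply: ideal_sum => // s _; case: II => _ _; apply.
exact: det_rowsub_maximal_minor.
Qed.

End MaximalMinors.

(** * Lifting linear maps out of free modules *)

Section LinearLift.
Variable R : comPzRingType.

Definition lin_comb (b : nat) (M : lmodType R) (v : 'I_b -> M)
    (x : 'rV[R]_b) : M :=
  \sum_i x 0 i *: v i.

Lemma lin_comb_is_linear (b : nat) (M : lmodType R) (v : 'I_b -> M) :
  linear (lin_comb v).
Proof.
move=> a x y; rewrite /lin_comb scaler_sumr -big_split /=.
by apply: eq_bigr => i _; rewrite !mxE scalerDl scalerA.
Qed.

HB.instance Definition _ (b : nat) (M : lmodType R) (v : 'I_b -> M) :=
  GRing.isLinear.Build R 'rV[R]_b M *:%R (lin_comb v) (lin_comb_is_linear v).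

Lemma linear_row_sum (b : nat) (M : lmodType R) (h : {linear 'rV[R]_b -> M}) x :
  h x = \sum_i x 0 i *: h (delta_mx 0 i).
Proof.
rewrite {1}[x]row_sum_delta linear_sum.
by apply: eq_bigr => i _; rewrite linearZ.
Qed.

(** Projectivity of [R^b]: preimages of the images of basis vectors are chosen and extended
    linearly. *)
Lemma linear_lift (b : nat) (M N : lmodType R) (g : {linear M -> N})
    (q : {linear 'rV[R]_b -> N}) :
  (forall x, exists y, g y = q x) ->
  exists t : {linear 'rV[R]_b -> M}, forall x, g (t x) = q x.
Proof.
move=> qg; have [v gv] := choice (fun i => qg (delta_mx 0 i)).
exists (lin_comb v) => x; rewrite [RHS]linear_row_sum /= linear_sum.
by apply: eq_bigr => i _; rewrite linearZ gv.
Qed.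

Lemma matrix_lift (b c : nat) (N : lmodType R) (p : {linear 'rV[R]_b -> N})
    (q : {linear 'rV[R]_c -> N}) :
  (forall x, exists y, p y = q x) ->
  exists C : 'M[R]_(c, b), forall x, p (x *m C) = q x.
Proof.
move=> /linear_lift[t pt]; exists (lin1_mx t) => x.
by rewrite mul_rV_lin1.
Qed.

End LinearLift.

(** * Minors of relations and independence of the cover *)

Section RelationMinors.
Variable R : comPzRingType.

(** Quantifying over all row combinations instead of single rows makes stability under left
    multiplication immediate. *)
Definition relations (m b : nat) (N : lmodType R) (p : {linear 'rV[R]_b -> N})
    (Z : 'M[R]_(m, b)) : Prop :=
  forall u : 'rV_m, p (u *m Z) = 0.

Definition relation_minors (b : nat) (N : lmodType R)
    (p : {linear 'rV[R]_b -> N}) : set R :=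
  [set \det B | B in [set B : 'M[R]_b | relations p B]].

Lemma relations_mulmx (m n b : nat) (N : lmodType R)
    (p : {linear 'rV[R]_b -> N}) (W : 'M[R]_(m, n)) (Z : 'M[R]_(n, b)) :
  relations p Z -> relations p (W *m Z).
Proof. by move=> pZ u; rewrite mulmxA. Qed.

Lemma relations_col_mx (m n b : nat) (N : lmodType R)
    (p : {linear 'rV[R]_b -> N}) (Y : 'M[R]_(m, b)) (Z : 'M[R]_(n, b)) :
  relations p Y -> relations p Z -> relations p (col_mx Y Z).
Proof.
by move=> pY pZ u; rewrite -[u]hsubmxK mul_row_col linearD pY pZ addr0.
Qed.

Lemma right_exact_relations (m a b : nat) (N : lmodType R) (A : 'M[R]_(a, b))
    (p : {linear 'rV[R]_b -> N}) {Z : 'M[R]_(m, b)} :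
  right_exact (mulmxr A) p -> relations p Z <-> exists W, Z = W *m A.
Proof.
move=> [pA _].
have kerE y : p y = 0 <-> exists u, u *m A = y.
  rewrite -[p y = 0]/((p @^-1` [set 0]) y) -pA.
  by split=> [[u _ <-]|[u <-]]; exists u.
split=> [pZ|[W ->] u]; last by apply/kerE; exists (u *m W); rewrite mulmxA.
have [W WA] := matrix_lift (p := mulmxr A) (q := mulmxr Z)
  (fun u => (kerE _).1 (pZ u)).
exists W; apply/row_matrixP=> i.
by rewrite [RHS]row_mul !rowE -[LHS]WA.
Qed.

Lemma maximal_minors_relation_minors (a b : nat) (N : lmodType R)
    (A : 'M[R]_(a, b)) (p : {linear 'rV[R]_b -> N}) :
  right_exact (mulmxr A) p ->
  ideal_gen (maximal_minors A) = ideal_gen (relation_minors p).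
Proof.
move=> pA; apply/seteqP.
split; apply: ideal_gen_le; try exact: ideal_gen_is_ideal.
  move=> _ [s _ <-]; apply: mem_ideal_gen; exists (rowsub s A) => //.
  by apply/(right_exact_relations pA); exists (rowsub s 1%:M); rewrite -rowsubE.
move=> _ [B /(right_exact_relations pA)[W ->] <-].
exact: det_mulmx_maximal_minor.
Qed.

(** Induction on [n]: Laplace expansion along the last column removes the columns beyond the first
    [b] one at a time. *)
Lemma det_colsub_relations (b n : nat) (N : lmodType R)
    (p : {linear 'rV[R]_b -> N}) (le_bn : (b <= n)%N) (M : 'M[R]_n) :
  relations p (colsub (widen_ord le_bn) M) ->
  ideal_gen (relation_minors p) (\det M).
Proof.
elim: n le_bn M => [|n IHn] le_bn M pM.
  have b0 : b = 0%N by apply/eqP; rewrite -leqn0.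
  subst b; apply: mem_ideal_gen; exists M => //.
  by rewrite [M]thinmx0 -[0](thinmx0 (colsub (widen_ord le_bn) M)).
have [eq_bn|lt_bn] := eqVneq b n.+1.
  subst b; apply: mem_ideal_gen; exists M => //.
  suff <- : colsub (widen_ord le_bn) M = M by [].
  by apply/matrixP=> i j; rewrite mxE; congr (M _ _); apply: val_inj.
have le_bn' : (b <= n)%N by rewrite -ltnS ltn_neqAle lt_bn.
rewrite (expand_det_col _ ord_max); apply: ideal_sum => [|i _].
  exact: ideal_gen_is_ideal.
have [_ _ IM] := ideal_gen_is_ideal (relation_minors p).
apply: (IM); apply: (IM); apply: (IHn le_bn').
(* Deleting row [i] and the last column leaves, in the first [b] columns, a selection of the old
   rows, hence still relations. *)
rewrite (_ : mxsub _ _ _ = rowsub (lift i) (colsub (widen_ord le_bn) M)).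
  by rewrite rowsubE; apply: relations_mulmx.
apply/matrixP=> k j; rewrite !mxE; congr (M _ _); apply: val_inj => /=.
by rewrite /bump leqNgt (leq_trans (ltn_ord j) le_bn').
Qed.

Lemma det_row_mx_relations (b c : nat) (N : lmodType R)
    (p : {linear 'rV[R]_b -> N}) (Z : 'M[R]_(b + c, b)) (W : 'M[R]_(b + c, c)) :
  relations p Z -> ideal_gen (relation_minors p) (\det (row_mx Z W)).
Proof.
move=> pZ; apply: (det_colsub_relations (le_bn := leq_addr c b)).
suff -> : colsub (widen_ord (leq_addr c b)) (row_mx Z W) = Z by [].
apply/matrixP=> i j; rewrite mxE -[RHS](row_mxEl Z W).
by congr (row_mx _ _ _ _); apply: val_inj.
Qed.

Lemma range_ex (M N : lmodType R) (h : {linear M -> N}) z :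
  range h = setT -> exists x, h x = z.
Proof. by move=> hT; have [x _ <-] : range h z by [rewrite hT]; exists x. Qed.

Lemma range_eq (M N : lmodType R) (h : {linear M -> N}) :
  (forall z, exists x, h x = z) -> range h = setT.
Proof.
by move=> hz; apply/seteqP; split=> // z _; have [x <-] := hz z; exists x.
Qed.

Lemma relation_minors_le (b c : nat) (N : lmodType R)
    (p : {linear 'rV[R]_b -> N}) (q : {linear 'rV[R]_c -> N}) :
  range p = setT -> range q = setT ->
  ideal_gen (relation_minors q) `<=` ideal_gen (relation_minors p).
Proof.
move=> pT qT; apply: ideal_gen_le; first exact: ideal_gen_is_ideal.
have [C pC] := matrix_lift (p := p) (q := q) (fun x => range_ex (q x) pT).
have [D qD] := matrix_lift (p := q) (q := p) (fun x => range_ex (p x) qT).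
move=> _ [B qB <-].
(* [C] and [D] translate between the covers. The left blocks are relations of [p], since [D *m C]
   preserves the value of [p] and [C] carries relations of [q] to relations of [p]. *)
have -> : \det B =
    \det (row_mx (col_mx (1%:M - D *m C) (B *m C)) (col_mx (- D) B)).
  transitivity (\det (block_mx 1%:M (- D) 0 B *m block_mx 1%:M 0 C 1%:M)).
    by rewrite det_mulmx det_ublock det_lblock !det1 !mul1r mulr1.
  by rewrite mulmx_block !mulmx1 !mulmx0 !add0r mulNmx block_mxEh.
apply: det_row_mx_relations; apply: relations_col_mx => u.
  by rewrite mulmxBr mulmx1 mulmxA linearB /= pC qD subrr.
by rewrite mulmxA pC qB.
Qed.

(** Independence of the cover compares [p] with every presentation; finite presentation supplies one
    for the inclusion into [Fit N]. *)
Lemma FitE (b : nat) (N : lmodType R) (p : {linear 'rV[R]_b -> N}) :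
  finitely_presented N -> range p = setT ->
  Fit N = ideal_gen (relation_minors p).
Proof.
move=> [a [c [A [q qA]]]] pT; apply/seteqP; split=> x.
  move=> [a' [c' [A' [[q' q'A'] ]]]].
  rewrite (maximal_minors_relation_minors q'A').
  by apply: relation_minors_le => //; case: q'A'.
move=> px; exists a, c, A; split; first by exists q.
rewrite (maximal_minors_relation_minors qA).
by apply: relation_minors_le px => //; case: qA.
Qed.

End RelationMinors.

(** * Covers and relations of an extension *)

Section Extension.
Variables (R : comPzRingType) (M1 M2 M3 : lmodType R).
Variables (f : {linear M1 -> M2}) (g : {linear M2 -> M3}).
Hypothesis fg : short_exact f g.
Variables (b c : nat).
Variables (p1 : {linear 'rV[R]_b -> M1}) (p3 : {linear 'rV[R]_c -> M3}).
Hypotheses (p1T : range p1 = setT) (p3T : range p3 = setT).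

Lemma short_exact_comp0 x : g (f x) = 0.
Proof.
have [_ [fg0 _]] := fg.
by have: range f (f x) by [exists x]; rewrite fg0.
Qed.

Lemma short_exact_kernel z : g z = 0 -> exists x, f (p1 x) = z.
Proof.
have [_ [fg0 _]] := fg => gz.
have [y _ <-] : range f z by rewrite fg0.
by have [x <-] := range_ex y p1T; exists x.
Qed.

(** As in the horseshoe lemma, [p2] is [f \o p1] on the first block and a lift of [p3] through [g]
    on the second. *)
Lemma extend_generators : exists (p2 : {linear 'rV[R]_(b + c) -> M2}),
  [/\ range p2 = setT, forall x, p2 (row_mx x 0) = f (p1 x)
    & forall x y, g (p2 (row_mx x y)) = p3 y].
Proof.
have [_ [_ gT]] := fg.
have [t gt] := linear_lift (g := g) (q := p3) (fun x => range_ex (p3 x) gT).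
pose p2 : {linear 'rV[R]_(b + c) -> M2} :=
  (f \o p1 \o lsubmx) \+ (t \o rsubmx).
have p2E x y : p2 (row_mx x y) = f (p1 x) + t y.
  by rewrite /p2 /= row_mxKl row_mxKr.
exists p2; split=> [|x|x y].
- apply: range_eq => z; have [y p3y] := range_ex (g z) p3T.
  have [x fx] : exists x, f (p1 x) = z - t y.
    by apply: short_exact_kernel; rewrite linearB /= gt p3y subrr.
  by exists (row_mx x y); rewrite p2E fx subrK.
- by rewrite p2E linear0 addr0.
- by rewrite p2E linearD /= short_exact_comp0 add0r gt.
Qed.

Variable p2 : {linear 'rV[R]_(b + c) -> M2}.
Hypothesis p2l : forall x, p2 (row_mx x 0) = f (p1 x).
Hypothesis p2r : forall x y, g (p2 (row_mx x y)) = p3 y.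

(** The value of [p2] on a row of [[0, B]] lies in the kernel of [g], hence in the image of [f], and
    [X] cancels it. *)
Lemma complete_relations m (B : 'M[R]_(m, c)) : relations p3 B ->
  exists X : 'M[R]_(m, b), relations p2 (row_mx X B).
Proof.
move=> p3B.
have [X fX] : exists X : 'M[R]_(m, b),
    forall u, f (p1 (u *m X)) = - p2 (u *m row_mx 0 B).
  apply: (matrix_lift (p := f \o p1)
    (q := \- (p2 \o mulmxr (row_mx 0 B)))) => u /=.
  by apply: short_exact_kernel; rewrite linearN /= mul_mx_row p2r p3B oppr0.
exists X => u.
have -> : u *m row_mx X B = row_mx (u *m X) 0 + u *m row_mx 0 B.
  by rewrite !mul_mx_row mulmx0 add_row_mx addr0 add0r.
by rewrite linearD p2l fX addNr.
Qed.

Lemma relation_minors_mul_le :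
  ideal_mul (ideal_gen (relation_minors p1)) (ideal_gen (relation_minors p3))
    `<=` ideal_gen (relation_minors p2).
Proof.
apply: ideal_mul_gen_le => [|_ _ [B p1B <-] [B' p3B' <-]].
  exact: ideal_gen_is_ideal.
have [X p2X] := complete_relations p3B'.
apply: mem_ideal_gen; exists (block_mx B 0 X B'); last exact: det_lblock.
apply: relations_col_mx => // u.
by rewrite mul_mx_row mulmx0 p2l p1B linear0.
Qed.

Lemma relation_minors_le_mul (A : 'M[R]_c) : right_exact (mulmxr A) p3 ->
  ideal_gen (relation_minors p2) `<=`
    ideal_mul (ideal_gen (relation_minors p1)) (ideal_gen (relation_minors p3)).
Proof.
move=> p3A; apply: ideal_gen_le; first exact: ideal_gen_is_ideal.
have p3relA : relations p3 A.
  by apply/(right_exact_relations p3A); exists 1%:M; rewrite mul1mx.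
have [X p2X] := complete_relations p3relA.
move=> _ [B p2B <-].
(* Applying [g] to a relation of [p2] shows that its right block is a relation of [p3]. *)
have [W BW] : exists W, rsubmx B = W *m A.
  apply/(right_exact_relations p3A) => u.
  by rewrite -(p2r (u *m lsubmx B)) -mul_mx_row hsubmxK p2B linear0.
have -> : B = row_mx (lsubmx B - W *m X) W *m block_mx 1%:M 0 X A.
  by rewrite mul_row_block !mulmx1 mulmx0 add0r subrK -BW hsubmxK.
rewrite det_mulmx det_lblock det1 mul1r; apply: mem_ideal_mul; last first.
  by apply: mem_ideal_gen; exists A.
apply: det_row_mx_relations => u; have [f_inj _] := fg; apply: f_inj.
rewrite linear0 -p2l.
(* Subtracting multiples of the relations [[X, A]] clears the right block; what remains is a
   relation of [p2], and injectivity of [f] makes its left block one of [p1]. *)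
suff -> : row_mx (u *m (lsubmx B - W *m X)) 0 = u *m B - u *m W *m row_mx X A.
  by rewrite linearB /= p2B p2X subrr.
rewrite -{2}[B]hsubmxK BW !mul_mx_row opp_row_mx add_row_mx mulmxBr !mulmxA.
by rewrite subrr.
Qed.

End Extension.

Theorem lemma2p13 (R : comPzRingType) (M1 M2 M3 : lmodType R)
    (fp1 : finitely_presented M1) (fp2 : finitely_presented M2)
    (fp3 : finitely_presented M3)
    (f : {linear M1 -> M2}) (g : {linear M2 -> M3}) (fg : short_exact f g) :
  ideal_mul (Fit M1) (Fit M3) `<=` Fit M2 /\
  (has_quadratic_presentation M3 -> ideal_mul (Fit M1) (Fit M3) = Fit M2).
Proof.
have [_ [b1 [_ [p1 [_ p1T]]]]] := fp1.
(* The cover of [M3] stays free: (i) takes any presentation, (ii) the square one. *)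
have extFit c (p3 : {linear 'rV[R]_c -> M3}) (p3T : range p3 = setT) :
    exists p2 : {linear 'rV[R]_(b1 + c) -> M2},
    [/\ Fit M2 = ideal_gen (relation_minors p2),
     forall x, p2 (row_mx x 0) = f (p1 x)
    & forall x y, g (p2 (row_mx x y)) = p3 y].
  have [p2 [p2T p2l p2r]] := extend_generators fg p1T p3T.
  by exists p2; split=> //; exact: FitE.
rewrite (FitE fp1 p1T); split.
  have [_ [b3 [_ [p3 [_ p3T]]]]] := fp3.
  have [p2 [-> p2l p2r]] := extFit _ _ p3T.
  by rewrite (FitE fp3 p3T); apply: (relation_minors_mul_le fg p1T p2l p2r).
case=> k [A [p3 p3A]]; have [_ p3T] := p3A.
have [p2 [-> p2l p2r]] := extFit _ _ p3T.
rewrite (FitE fp3 p3T); apply/seteqP; split.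
  exact: (relation_minors_mul_le fg p1T p2l p2r).
exact: (relation_minors_le_mul fg p1T p2l p2r p3A).
Qed.
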